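(* Let $d \geq 1$ be an integer, let $N > 1$ be a composite integer and let $R = \mathbb{Z}/N\mathbb{Z}$. Consider the coefficient-choosing game of degree $d$ over $R$, where Wanda wins if and only if the final polynomial has a root in $R$. Then the player who makes the last move has a winning strategy when (1) $d$ is even, or (2) $d > 1$ and $N$ is cube-free, or (3) $d > 3$ and $N = 16 N_2$ for some cube-free odd integer $N_2$. In all other cases, Wanda has a winning strategy, whether she moves first or second.
   Context: The coefficient-choosing game of degree $d$ over a commutative ring $R$ with unity: two players, Nora and Wanda, alternately choose coefficients of a polynomial $f(x) = a_d x^d + \cdots + a_1 x + a_0$. On each move the player whose turn it is picks one coefficient $a_i$ that has not yet been chosen and assigns it a value in $R$. The leading coefficient $a_d$ and the constant coefficient $a_0$ must be nonzero. The game ends when all $d+1$ coefficients are chosen. Wanda wins if $f$ has a root in the ring of fractions $\operatorname{Frac}(R)$, and Nora wins otherwise. For $R = \mathbb{Z}/N\mathbb{Z}$, $\operatorname{Frac}(R) = R$. Who moves first is fixed in advance, which determines who makes the last (i.e. the $(d+1)$-st) move. ''The last player has a winning strategy'' means that whichever of the two players makes the last move has a winning strategy. *)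

(* Defs.v *)
From HB Require Import structures.
From mathcomp Require Import all_boot all_order all_algebra.

Import GRing.Theory.
Local Open Scope ring_scope.

Definition Wanda : bool := true.
Definition Nora : bool := false.

(* A position of the degree-d game over 'Z_N: coefficient j (j <= d) is
   either chosen (Some a_j) or not yet chosen (None). *)
Definition position (N : nat) := nat -> option 'Z_N.

Definition start_pos (N : nat) : position N := fun _ => None.

Definition legal_move (N d : nat) (p : position N) (i : 'I_d.+1) (v : 'Z_N) : Prop :=
  p i = None /\ ((val i == 0%N) || (val i == d) -> v != 0).

Definition play (N : nat) (p : position N) (i : nat) (v : 'Z_N) : position N :=
  fun j => if j == i then Some v else p j.

Definition final_poly (N d : nat) (p : position N) : {poly 'Z_N} :=
  \poly_(j < d.+1) odflt 0 (p j).

Definition wanda_wins_final (N d : nat) (p : position N) : Prop :=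
  exists x : 'Z_N, root (final_poly N d p) x.

Fixpoint has_ws (N d : nat) (pl : bool) (n : nat) (turn : bool) (p : position N)
  : Prop :=
  match n with
  | 0%N => if pl then wanda_wins_final N d p else ~ wanda_wins_final N d p
  | n'.+1 =>
      if turn == pl then
        exists (i : 'I_d.+1) (v : 'Z_N),
          legal_move N d p i v /\ has_ws N d pl n' (~~ turn) (play N p i v)
      else
        forall (i : 'I_d.+1) (v : 'Z_N),
          legal_move N d p i v -> has_ws N d pl n' (~~ turn) (play N p i v)
  end.

Definition wins_game (N d : nat) (pl first : bool) : Prop :=
  has_ws N d pl d.+1 first (start_pos N).

Definition last_player (d : nat) (first : bool) : bool :=
  if odd d.+1 then first else ~~ first.

Definition cube_free (n : nat) : Prop :=
  forall p : nat, prime p -> ~~ (p ^ 3 %| n)%N.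

Definition composite (N : nat) : Prop := (1 < N)%N /\ ~~ prime N.

(* Main.v *)
(** If Wanda moves last, she secures both end coefficients early and uses the
    last, interior, coefficient to make 1 a root; degrees 1, 2 and 3 are treated
    by hand, playing 1 against -1.

    If Nora moves last, let q be a prime factor of N.  Modulo q the last
    coefficient kills each of the q - 1 units as a root for all but one of its q
    residues, so Nora only has to make sure that no multiple of q is a root.  She
    achieves this with a_0 = 1, or, when Wanda has chosen a_0 divisible by all
    the primes of N but not by q^2 | N, with a_1 = 0.  When 16 | N and 4 | a_0,
    she plays a_1 = 0 and then keeps a_0/4 + a_2 + 2 a_3 nonzero mod 4.

    If moreover e := v_p(N) >= 3, take the idempotent E = 1 mod p^e which is 0
    modulo N/p^e.  When a_0 is a multiple of E, f(E z) = E f(z), so it suffices to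
    make f(z) divisible by p^e.  Wanda opens with a_0 = E p^(e-1) (a_0 = E p^2 if
    e = 4).  As a_0^2 = 0, Nora must answer on a_1, for otherwise a_1 = 1 makes
    -a_0 a root; a suitable a_2 then forces a root, by Hensel lifting if e = 4. *)
From HB Require Import structures.
Require Import Defs.
From mathcomp Require Import all_boot all_order all_algebra.
From mathcomp Require Import ring zify.
Set Implicit Arguments.
Unset Strict Implicit.
Unset Printing Implicit Defensive.
Import GRing.Theory.
Local Open Scope ring_scope.

(** * Positions, their extensions, and strategies *)

Section Positions.
Variables N d : nat.
Implicit Types (p q : position N) (i : 'I_d.+1) (v x : 'Z_N).

Definition unchosen p := [pred i : 'I_d.+1 | p i == None].

(** A property required of all extensions of a position survives every later move; winning
    conditions are stated in this form. *)
Definition extends p q := forall j a, p j = Some a -> q j = Some a.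

Lemma extends_refl p : extends p p.
Proof. by []. Qed.

Lemma extends_play p q i v :
  extends p q -> q i = None -> extends p (play N q i v).
Proof.
move=> pq qi j a /pq; rewrite /play.
by case: eqP => // -> ; rewrite qi.
Qed.

Lemma card_unchosen_start : #|unchosen (start_pos N)| = d.+1.
Proof. by rewrite -[RHS]card_ord; apply: eq_card => i; rewrite !inE. Qed.

Lemma card_unchosen_play p i v n :
  p i = None -> #|unchosen p| = n.+1 -> #|unchosen (play N p i v)| = n.
Proof.
move=> pi; rewrite (cardD1 i) inE pi eqxx add1n => -[<-].
apply: eq_card => j; rewrite !inE /play -[val j == val i]/(j == i).
by case: (j == i).
Qed.

Lemma unchosen_witness p n : #|unchosen p| = n.+1 -> exists i, p i = None.
Proof.
move=> pn; have /card_gt0P[i] : (0 < #|unchosen p|)%N by rewrite pn.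
by rewrite inE => /eqP; exists i.
Qed.

Lemma horner_final_play p i v x : p i = None ->
  (final_poly N d (play N p i v)).[x] = (final_poly N d p).[x] + v * x ^+ i.
Proof.
move=> pi; rewrite /final_poly !horner_poly (bigD1 i) //= [in RHS](bigD1 i) //=.
rewrite pi /play eqxx /= mul0r add0r addrC; congr (_ + _).
by apply: eq_bigr => j; rewrite -[val j == val i]/(j == i) => /negbTE->.
Qed.

Lemma coef_final p j a : (j <= d)%N -> p j = Some a -> (final_poly N d p)`_j = a.
Proof. by move=> jd pj; rewrite coef_poly ltnS jd pj. Qed.

Lemma legal_nonzero p i v : p i = None -> v != 0 -> legal_move N d p i v.
Proof. by []. Qed.

Lemma legal_one p i : p i = None -> legal_move N d p i 1.
Proof. by move=> pi; apply: legal_nonzero; rewrite ?oner_neq0. Qed.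

(** For use once the chosen coefficients already force a root: the rest of the game is irrelevant,
    and 1 is a legal value at any free index. *)
Lemma wanda_certain p n turn :
    (forall q, extends p q -> wanda_wins_final N d q) ->
  #|unchosen p| = n -> has_ws N d Wanda n turn p.
Proof.
elim: n turn p => [|n IHn] turn p pW pn /=; first exact/pW/extends_refl.
have next i v : p i = None -> has_ws N d Wanda n (~~ turn) (play N p i v).
  move=> pi; apply: IHn; last exact: card_unchosen_play pi pn.
  move=> q pq; apply: pW => j a pj; apply: pq.
  exact: (extends_play v (@extends_refl p) pi).
case: ifP => _; last by move=> i v [/next].
have [i pi] := unchosen_witness pn.
by exists i, 1; split; [exact: legal_one | exact: next].
Qed.

Lemma has_ws_move pl p n i v : legal_move N d p i v ->
  has_ws N d pl n (~~ pl) (play N p i v) -> has_ws N d pl n.+1 pl p.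
Proof. by move=> pv w; rewrite /= eqxx; exists i, v. Qed.

Lemma has_ws_reply pl p n :
    (forall i v, legal_move N d p i v -> has_ws N d pl n pl (play N p i v)) ->
  has_ws N d pl n.+1 (~~ pl) p.
Proof. by move=> w /=; rewrite negbK; case: eqP => //; case: pl {w}. Qed.

(** The parity condition says that [pl] makes the last of the n + 1 remaining moves. Since every
    extension can be finished off, [pl] may play 1 anywhere until then. *)
Lemma last_mover_wins pl p n turn :
    (forall q i, extends p q -> q i = None ->
       exists v, legal_move N d q i v /\
         forall t, has_ws N d pl 0 t (play N q i v)) ->
    #|unchosen p| = n.+1 -> turn = (pl (+) odd n) ->
  has_ws N d pl n.+1 turn p.
Proof.
elim: n turn p => [|n IHn] turn p pW pn ->.
  have [i pi] := unchosen_witness pn.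
  have [v [pv v_win]] := pW p i (@extends_refl p) pi.
  by rewrite addbF; exact: has_ws_move pv (v_win _).
have next i v : p i = None ->
    has_ws N d pl n.+1 (~~ (pl (+) odd n.+1)) (play N p i v).
  move=> pi; apply: IHn; last by rewrite /= addbN negbK.
    move=> q k pq; apply: pW => j a pj; apply: pq.
    exact: (extends_play v (@extends_refl p) pi).
  exact: card_unchosen_play pi pn.
have [i pi] := unchosen_witness pn.
move: next; rewrite -[odd n.+1]/(~~ odd n) addbN negbK.
case: (odd n); rewrite ?addbT ?addbF => next.
  by rewrite negbK; apply: has_ws_move (next i 1 pi); exact: legal_one.
by apply: has_ws_reply => k v [/next].
Qed.

Lemma legal_interior p i v : p i = None -> (0 < i < d)%N -> legal_move N d p i v.
Proof. by move=> pi /andP[i0 id]; split=> //; rewrite gtn_eqF // ltn_eqF. Qed.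

End Positions.

(** * Wanda moves last *)

Section WandaLast.
Variables N d : nat.
Hypothesis N_gt2 : (2 < N)%N.
Implicit Types (p q : position N).

Lemma natrZ_eq0 n : (n%:R == 0 :> 'Z_N) = (N %| n)%N.
Proof. by rewrite -val_eqE /= val_Zp_nat ?(ltnW N_gt2). Qed.

Lemma two_neq0 : 2%:R != 0 :> 'Z_N.
Proof. by rewrite natrZ_eq0 gtnNdvd. Qed.

(** The last coefficient that makes 1 (or -1) a root is F(1) (or F(-1)) up to sign, so at an end it
    is legal as soon as that value is nonzero. *)
Lemma wanda_last_move p (i : 'I_d.+1) : p i = None ->
    (0 < i < d)%N \/ (final_poly N d p).[1] != 0 \/ (final_poly N d p).[-1] != 0 ->
  exists v, legal_move N d p i v /\
    forall t, has_ws N d Wanda 0 t (play N p i v).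
Proof.
set F := final_poly N d p => pi.
have root1 : wanda_wins_final N d (play N p i (- F.[1])).
  by exists 1; rewrite /root horner_final_play // expr1n mulr1 addrN.
case=> [i_int | [F1 | FN1]].
- by exists (- F.[1]); split=> [|t]; [exact: legal_interior | exact: root1].
- exists (- F.[1]); split=> [|t]; last exact: root1.
  by apply: legal_nonzero; rewrite ?oppr_eq0.
exists (- ((-1) ^+ i * F.[-1])); split=> [|t].
  by apply: legal_nonzero; rewrite // oppr_eq0 mulrI_eq0 //; apply/lregX/lregN/lreg1.
exists (-1); rewrite /root horner_final_play // mulNr mulrAC -exprMn.
by rewrite mulrNN mulr1 expr1n mul1r addrN.
Qed.

Lemma wanda_last_interior p n :
    p 0%N <> None -> p d <> None -> #|unchosen d p| = n.+1 ->
  has_ws N d Wanda n.+1 (~~ odd n) p.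
Proof.
move=> p0 pd pn; apply: last_mover_wins pn _ => // q i pq qi.
apply: wanda_last_move => //; left.
have chosen (j : nat) : p j <> None -> (i : nat) <> j.
  by case pj: (p j) => [a|] // _ ij; move: qi; rewrite ij (pq _ _ pj).
by rewrite lt0n ltn_neqAle -ltnS ltn_ord andbT; apply/andP; split; apply/eqP/chosen.
Qed.

Lemma play_neq_None p i v j : p j <> None -> play N p i v j <> None.
Proof. by rewrite /play; case: eqP. Qed.

Lemma play_self p i v : play N p i v i = Some v.
Proof. by rewrite /play eqxx. Qed.

(* Here [k] is an end already chosen and [l] the other end. *)
Lemma wanda_last_one_end p n (k l : 'I_d.+1) :
    (forall q, q k <> None -> q l <> None -> q 0%N <> None /\ q d <> None) ->
    p k <> None -> #|unchosen d p| = n.+3 -> ~~ odd n ->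
  has_ws N d Wanda n.+3 Wanda p.
Proof.
move=> ends pk pn n_even.
case pl: (p l) => [a|].
  have [p0 pd] := ends p pk (ltac:(by rewrite pl)).
  by have := wanda_last_interior p0 pd pn; rewrite /= negbK n_even.
apply: (has_ws_move (legal_one pl)).
have pl' : play N p l 1 l <> None by rewrite play_self.
have [p0 pd] := ends _ (@play_neq_None _ l 1 _ pk) pl'.
have := wanda_last_interior p0 pd (card_unchosen_play 1 pl pn).
by rewrite /= n_even.
Qed.

(** With an odd number of free coefficients, at least five, Wanda has two moves before her last one,
    enough to settle both ends. *)
Lemma wanda_last_no_end p n : #|unchosen d p| = n.+1.+4 -> ~~ odd n ->
  has_ws N d Wanda n.+1.+4 Wanda p.
Proof.
move=> pn n_even.
have ends (q : position N) : q (ord0 : 'I_d.+1) <> None ->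
  q (ord_max : 'I_d.+1) <> None -> q 0%N <> None /\ q d <> None by [].
case p0: (p (ord0 : 'I_d.+1)) => [a|].
  by apply: (wanda_last_one_end ends) => //=; rewrite ?p0 //= negbK.
apply: (has_ws_move (legal_one p0)).
apply: (@has_ws_reply _ _ Wanda) => i v [qi _].
apply: (wanda_last_one_end ends) => //.
  by apply: play_neq_None; rewrite play_self.
exact: card_unchosen_play qi (card_unchosen_play 1 p0 pn).
Qed.


Lemma horner_start x : (final_poly N d (start_pos N)).[x] = 0.
Proof. by rewrite horner_poly big1 // => i _; rewrite mul0r. Qed.

End WandaLast.

Lemma wanda_wins_last N d first : (2 < N)%N -> (0 < d)%N ->
  last_player d first = Wanda -> wins_game N d Wanda first.
Proof.
move=> N_gt2; rewrite /wins_game /last_player.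
have two0 := two_neq0 N_gt2.
case: d => [|[|[|[|d]]]] // _.
- case: first => // _; apply: (@has_ws_reply _ _ Wanda) => i v iv.
  have [j pj] := unchosen_witness (card_unchosen_play v (proj1 iv) (@card_unchosen_start N 1)).
  have [|w [jw win]] := wanda_last_move pj; last exact: has_ws_move jw (win _).
  (* In degree 1 both coefficients are ends, so F(1) = v is nonzero. *)
  right; left; rewrite horner_final_play // horner_start expr1n mulr1 add0r.
  by case: iv => _; apply; case: i pj => [[|[|]]].
- case: first => // _; apply: (@has_ws_move _ _ Wanda _ _ (Ordinal (isT : 2 < 3)%N) 1); first exact: legal_one.
  apply: (@has_ws_reply _ _ Wanda) => i v [pi _].
  have card1 : #|unchosen 2 (play N (play N (start_pos N) 2 1) i v)| = 1%N.
    apply: card_unchosen_play => //.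
    by apply: (@card_unchosen_play _ _ _ (Ordinal (isT : 2 < 3)%N)) => //; exact: card_unchosen_start.
  case: i pi card1 => [[|[|[|//]]] i_lt] // pi card1.
    by apply: (@wanda_last_interior _ _ _ 0 _ _ card1); rewrite /play /=.
  have [j pj] := unchosen_witness card1.
  have [|w [jw win]] := wanda_last_move pj; last exact: has_ws_move jw (win _).
  (* Nora chose a_1 = v, so F(1) + F(-1) = (1 + v) + (1 - v) = 2, and F(1), F(-1) are not both
     zero. *)
  right; apply/orP; rewrite -negb_and; apply: contra two0 => /andP[/eqP F1 /eqP FN1].
  have := congr2 +%R F1 FN1.
  rewrite !(@horner_final_play _ _ _ (Ordinal i_lt)) //.
  rewrite !(@horner_final_play _ _ _ (Ordinal (isT : 2 < 3)%N)) // !horner_start /= => e.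
  by apply/eqP; rewrite -[RHS]addr0 -e; ring.
(* In degree 3, if Nora opens with an interior v, Wanda puts c at the end whose index has the same
   parity. If Nora then takes the other interior coefficient, 2 (v + c) is F(1) - F(-1) or F(1) +
   F(-1), so it must be nonzero. If c = 1 fails, c = 2 works, as then 2 (v + 2) = 2. *)
- have [c_of c_of0 c_of2] : exists2 c : 'Z_N -> 'Z_N,
    forall v, c v != 0 & forall v, 2%:R * (v + c v) != 0.
    exists (fun v => if 2%:R * (v + 1) == 0 then 2%:R else 1) => v.
      by case: ifP; rewrite ?oner_neq0.
    case: ifPn => // /eqP e; apply: contra two0 => /eqP e2.
    by apply/eqP; rewrite -[RHS](subrr 0) -{1}e2 -e; ring.
  case: first => // _; apply: (@has_ws_reply _ _ Wanda) => i v [pi _].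
  have card3 := card_unchosen_play v pi (@card_unchosen_start N 3).
  case: i pi card3 => [[|[|[|[|//]]]] i_lt] // pi card3.
  + exact: (@wanda_last_one_end _ _ _ 0 ord0 ord_max).
  + apply: (@has_ws_move _ _ Wanda _ _ ord_max (c_of v)); first exact: legal_nonzero.
    apply: (@has_ws_reply _ _ Wanda) => j w [qj _].
    have card1 := card_unchosen_play w qj (@card_unchosen_play _ _ _ ord_max (c_of v) _ erefl card3).
    case: j qj card1 => [[|[|[|[|//]]]] j_lt] // qj card1; first
      by apply: (@wanda_last_interior _ _ _ 0 _ _ card1); rewrite /play /=.
    have [l pl] := unchosen_witness card1.
    have [|u [lu win]] := wanda_last_move pl; last exact: has_ws_move lu (win _).
    right; apply/orP; rewrite -negb_and; apply: contra (c_of2 v) => /andP[/eqP F1 /eqP FN1].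
    have /= := congr2 (fun x y : 'Z_N => x - y) F1 FN1.
    rewrite !(@horner_final_play _ _ _ (Ordinal j_lt)) //.
    rewrite !(@horner_final_play _ _ _ ord_max) //.
    rewrite !(@horner_final_play _ _ _ (Ordinal i_lt)) // !horner_start /= => e.
    by apply/eqP; rewrite -[RHS](subr0 0) -e; ring.
  + apply: (@has_ws_move _ _ Wanda _ _ ord0 (c_of v)); first exact: legal_nonzero.
    apply: (@has_ws_reply _ _ Wanda) => j w [qj _].
    have card1 := card_unchosen_play w qj (@card_unchosen_play _ _ _ ord0 (c_of v) _ erefl card3).
    case: j qj card1 => [[|[|[|[|//]]]] j_lt] // qj card1; last
      by apply: (@wanda_last_interior _ _ _ 0 _ _ card1); rewrite /play /=.
    have [l pl] := unchosen_witness card1.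
    have [|u [lu win]] := wanda_last_move pl; last exact: has_ws_move lu (win _).
    right; apply/orP; rewrite -negb_and; apply: contra (c_of2 v) => /andP[/eqP F1 /eqP FN1].
    have := congr2 +%R F1 FN1.
    rewrite !(@horner_final_play _ _ _ (Ordinal j_lt)) //.
    rewrite !(@horner_final_play _ _ _ ord0) //.
    rewrite !(@horner_final_play _ _ _ (Ordinal i_lt)) // !horner_start /= => e.
    by apply/eqP; rewrite -[RHS](addr0 0) -e; ring.
  + exact: (@wanda_last_one_end _ _ _ 0 ord_max ord0).
- rewrite -[odd d.+1.+4]/(~~ ~~ ~~ ~~ ~~ odd d) !negbK.
  have [d_odd|d_even] := boolP (odd d); case: first => // _.
    case: d d_odd => // d d_even.
    apply: (@has_ws_reply _ _ Wanda) => i v [pi _].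
    by apply: wanda_last_no_end => //; exact: card_unchosen_play pi (@card_unchosen_start N _).
  by apply: wanda_last_no_end => //; exact: card_unchosen_start.
Qed.

(** * Reduction modulo a prime factor of N *)

Lemma avoid_units (F : finFieldType) (g : {poly F}) (i : nat) :
  exists r, forall y, y != 0 -> g.[y] + r * y ^+ i != 0.
Proof.
(* The forbidden values of r, one for each nonzero y, hence fewer than the elements of F. *)
pose A := [set - g.[y] / y ^+ i | y in [set~ 0]].
have /subsetPn[r _ rA] : ~~ ([set: F] \subset A).
  apply/negP => /subset_leq_card; rewrite cardsT leqNgt => /negP; apply.
  rewrite (leq_ltn_trans (leq_imset_card _ _)) // cardsC1 ltn_predL.
  by apply/card_gt0P; exists 0.
exists r => y y0; apply: contraNneq rA => /eqP; rewrite addrC addr_eq0 => /eqP e.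
by apply/imsetP; exists y; rewrite ?inE // -e mulfK // expf_neq0.
Qed.

Section Reduction.
Variables N q : nat.
Hypotheses (N_gt1 : (1 < N)%N) (q_pr : prime q) (qN : (q %| N)%N).

Let red (x : 'Z_N) : 'F_q := (val x)%:R.

Let red_mod n : (n %% (Zp_trunc N).+2)%:R = n%:R :> 'F_q.
Proof.
rewrite [in RHS](divn_eq n (Zp_trunc N).+2) natrD natrM.
suff -> : (Zp_trunc N).+2%:R = 0 :> 'F_q by rewrite mulr0 add0r.
by apply/eqP; rewrite -(dvdn_pcharf (pchar_Fp q_pr)) Zp_cast.
Qed.

Lemma mod_prime_morphism :
  exists f : {rmorphism 'Z_N -> 'F_q}, forall x, f x = 0 -> exists w, x = q%:R * w.
Proof.
have redB : zmod_morphism red.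
  have redD : {morph red : x y / x + y}.
    by move=> x y; rewrite /red /= red_mod natrD.
  move=> x y; apply/eqP; rewrite -subr_eq opprK eq_sym -redD subrK //.
have redM : monoid_morphism red.
  split=> [|x y]; last by rewrite /red /= red_mod natrM.
  by rewrite /red /= red_mod.
pose f : {rmorphism 'Z_N -> 'F_q} := HB.pack red
  (GRing.isZmodMorphism.Build _ _ red redB) (GRing.isMonoidMorphism.Build _ _ red redM).
exists f => x; rewrite /f /= /red => /eqP; rewrite -(dvdn_pcharf (pchar_Fp q_pr)).
by case/dvdnP => w e; exists w%:R; rewrite -[x]natr_Zp e natrM mulrC.
Qed.

End Reduction.

(** * Splitting off the low-degree terms of a polynomial *)

Section HornerSplit.
Variables (R : comNzRingType) (P : {poly R}).

Lemma horner_split n : exists h : {poly R}, forall x,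
  P.[x] = \sum_(i < n) P`_i * x ^+ i + x ^+ n * h.[x].
Proof.
exists (drop_poly n P) => x; rewrite -{1}(poly_take_drop n P) hornerD hornerM hornerXn.
by rewrite horner_poly mulrC.
Qed.

Lemma horner_split1 : exists h : {poly R}, forall x, P.[x] = P`_0 + x * h.[x].
Proof.
by have [h hP] := horner_split 1; exists h => x; rewrite hP big_ord1 mulr1.
Qed.

Lemma horner_split2 : exists h : {poly R}, forall x,
  P.[x] = P`_0 + P`_1 * x + x ^+ 2 * h.[x].
Proof.
have [h hP] := horner_split 2; exists h => x.
by rewrite hP !big_ord_recl big_ord0 /= mulr1 addr0.
Qed.

Lemma horner_split3 : exists h : {poly R}, forall x,
  P.[x] = P`_0 + P`_1 * x + P`_2 * x ^+ 2 + x ^+ 3 * h.[x].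
Proof.
have [h hP] := horner_split 3; exists h => x.
by rewrite hP !big_ord_recl big_ord0 /= mulr1 addr0 !addrA.
Qed.

Lemma horner_split4 : exists h : {poly R}, forall x,
  P.[x] = P`_0 + P`_1 * x + P`_2 * x ^+ 2 + P`_3 * x ^+ 3 + x ^+ 4 * h.[x].
Proof.
have [h hP] := horner_split 4; exists h => x.
by rewrite hP !big_ord_recl big_ord0 /= mulr1 addr0 !addrA.
Qed.

End HornerSplit.

(** * Nora moves last *)

Section NoraLast.
Variables N d q : nat.
Hypotheses (q_pr : prime q) (qN : (q %| N)%N) (q_lt : (q < N)%N).
Implicit Types p : position N.

Let N_gt1 : (1 < N)%N. Proof. exact: ltn_trans (prime_gt1 q_pr) q_lt. Qed.
Let N_gt2 : (2 < N)%N. Proof. exact: leq_ltn_trans (prime_gt1 q_pr) q_lt. Qed.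

(** Only the residue of v modulo q is prescribed, by [avoid_units]; this excludes the roots that are
    units modulo q, and the hypothesis excludes the others for every v. *)
Lemma nora_last_move p (i : 'I_d.+1) : p i = None ->
    (forall v w, (final_poly N d (play N p i v)).[q%:R * w] != 0) ->
  exists v, legal_move N d p i v /\
    forall t, has_ws N d Nora 0 t (play N p i v).
Proof.
move=> pi noroot; set F := final_poly N d p.
have [f fP] := mod_prime_morphism N_gt1 q_pr qN.
have fq : f q%:R = 0 by rewrite rmorph_nat; apply/eqP; rewrite -(dvdn_pcharf (pchar_Fp q_pr)).
have [r rP] := avoid_units (map_poly f F) i.
(* The residue 0 is represented by q, which is nonzero because q < N, so v is legal even at an
   end. *)
have [v v0 fv] : exists2 v : 'Z_N, v != 0 & f v = r.
  have [->|r0] := eqVneq r 0.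
    by exists q%:R; rewrite // natrZ_eq0 // gtnNdvd // prime_gt0.
  exists (val r)%:R; last by rewrite rmorph_nat natr_Zp.
  by apply: contraNneq r0 => /(congr1 f); rewrite rmorph0 rmorph_nat natr_Zp => ->.
exists v; split=> // t [x rx].
have [/fP[w xw]|fx] := eqVneq (f x) 0.
  by have := noroot v w; rewrite -xw (eqP rx) eqxx.
have := rP _ fx; rewrite -fv horner_map -rmorphXn -rmorphM -rmorphD.
by rewrite -horner_final_play // (eqP rx) rmorph0 eqxx.
Qed.

Lemma nora_last_wins p n :
    (forall p', extends p p' -> forall w, (final_poly N d p').[q%:R * w] != 0) ->
    #|unchosen d p| = n.+1 ->
  has_ws N d Nora n.+1 (odd n) p.
Proof.
move=> noroot pn; apply: last_mover_wins pn _ => // p' i pp' pi.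
by apply: nora_last_move => // v w; apply: noroot; exact: extends_play.
Qed.

Lemma dvdn_val_mul m (w : 'Z_N) : (m %| N)%N -> (m %| val (m%:R * w)%R)%N.
Proof.
move=> mN; rewrite -[w]natr_Zp -natrM /= val_Zp_nat //.
by rewrite /dvdn modn_dvdm // modnMr.
Qed.

(** Modulo q, f(q w) is the constant c, which does not vanish. *)
Lemma nora_last_unit p n c :
    p 0%N = Some c -> ~~ (q %| val c)%N -> #|unchosen d p| = n.+1 ->
  has_ws N d Nora n.+1 (odd n) p.
Proof.
move=> p0 qc; apply: nora_last_wins => p' pp' w; apply: contra qc => /eqP.
have [h ->] := horner_split1 (final_poly N d p').
rewrite (coef_final (leq0n d) (pp' _ _ p0)) => /eqP.
by rewrite addr_eq0 -mulrA -mulrN => /eqP->; exact: dvdn_val_mul.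
Qed.

(** With a_1 = 0, f(q w) is c modulo q^2. *)
Lemma nora_last_square p n c :
    (0 < d)%N -> p 0%N = Some c -> p 1%N = Some 0 ->
    (q ^ 2 %| N)%N -> ~~ (q ^ 2 %| val c)%N -> #|unchosen d p| = n.+1 ->
  has_ws N d Nora n.+1 (odd n) p.
Proof.
move=> d0 p0 p1 q2N q2c; apply: nora_last_wins => p' pp' w; apply: contra q2c => /eqP.
have [h ->] := horner_split2 (final_poly N d p').
rewrite (coef_final (leq0n d) (pp' _ _ p0)) (coef_final d0 (pp' _ _ p1)).
rewrite mul0r addr0 => /eqP.
rewrite addr_eq0 exprMn -natrX -mulrA -mulrN => /eqP->; exact: dvdn_val_mul.
Qed.

End NoraLast.

(* For even w the sum is e modulo 4, for odd w it is e + a + 2 b. *)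
Lemma nat_cubic4 (e a b w : nat) : ~~ (4 %| e)%N -> ~~ (4 %| e + a + 2 * b)%N ->
  ~~ (4 %| e + a * w ^ 2 + 2 * b * w ^ 3)%N.
Proof.
move=> e4 eab4; rewrite -[w]odd_double_half; set t := w./2.
case: (odd w); rewrite /= -muln2.
  have -> : (e + a * (1 + t * 2) ^ 2 + 2 * b * (1 + t * 2) ^ 3 = e + a + 2 * b +
    4 * (a * (t + t ^ 2) + b * (3 * t + 6 * t ^ 2 + 4 * t ^ 3)))%N by ring.
  by rewrite dvdn_addl ?dvdn_mulr.
have -> : (e + a * (0 + t * 2) ^ 2 + 2 * b * (0 + t * 2) ^ 3 = e +
  4 * (a * t ^ 2 + 4 * b * t ^ 3))%N by ring.
by rewrite dvdn_addl ?dvdn_mulr.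
Qed.

(** Here q = 2: modulo 16, f(2 w) = 4 (e + a_2 w^2 + 2 a_3 w^3), and [nat_cubic4] keeps the bracket
    nonzero modulo 4. The default 0 agrees with [final_poly]. *)
Lemma nora_last_16 N d (p : position N) n e :
    (16 %| N)%N -> (0 < N)%N -> (3 <= d)%N ->
    p 0%N = Some (4 * e)%:R -> p 1%N = Some 0 -> ~~ (4 %| e)%N ->
    (forall p', extends p p' ->
       ~~ (4 %| e + val (odflt 0%R (p' 2)) + 2 * val (odflt 0%R (p' 3)))%N) ->
    #|unchosen d p| = n.+1 ->
  has_ws N d Nora n.+1 (odd n) p.
Proof.
move=> N16 N0 d3 p0 p1 e4 eab.
have N16' := dvdn_leq N0 N16.
apply: (@nora_last_wins N d 2) => //.
- by rewrite (dvdn_trans _ N16).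
- by rewrite (leq_trans _ N16').
move=> p' pp' w.
have [h ->] := horner_split4 (final_poly N d p').
rewrite (coef_final (leq0n d) (pp' _ _ p0)) (coef_final _ (pp' _ _ p1)) 1?ltnW 1?ltnW //.
rewrite !coef_poly !ltnS d3 (ltnW d3).
have := nat_cubic4 (val w) e4 (eab _ pp').
set a := odflt 0 (p' 2); set b := odflt 0 (p' 3).
apply: contra; move: (h.[_]) => y E.
(* Writing f(2 w) as the image of a natural number turns its vanishing into divisibility by N, hence
   by 16, and a factor 4 cancels. *)
have {E} : (4 * (e + val a * val w ^ 2 + 2 * val b * val w ^ 3 + 4 * (val w ^ 4 * val y)))%:R == 0 :> 'Z_N.
  rewrite -(eqP E) !(natrM, natrD, natrX) !natr_Zp; apply/eqP; ring.
rewrite natrZ_eq0 ?(leq_trans _ N16') // => /(dvdn_trans N16).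
by rewrite -[16%N]/(4 * 4)%N dvdn_pmul2l // dvdn_addl // dvdn_mulr.
Qed.

Lemma nora_wins_even N d : composite N -> (0 < d)%N -> ~~ odd d ->
  wins_game N d Nora Nora.
Proof.
case=> N_gt1 Npr; case: d => // d _; rewrite /= negbK => d_odd.
have q_pr := pdiv_prime N_gt1; have qN := pdiv_dvd N.
have q_lt : (pdiv N < N)%N.
  rewrite ltn_neqAle pdiv_leq ?(ltnW N_gt1) // andbT.
  by apply: contraNneq Npr => <-.
apply: (@has_ws_move _ _ Nora _ _ ord0 1); first exact: legal_one.
have -> : ~~ Nora = odd d by rewrite d_odd.
apply: (nora_last_unit q_pr qN q_lt (c := 1)) => //.
  by rewrite /= modn_small ?Zp_cast // Euclid_dvd1.
by apply: (@card_unchosen_play _ _ _ ord0) => //; exact: card_unchosen_start.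
Qed.


Lemma composite_prime_lt N q : composite N -> q \in primes N ->
  [/\ prime q, q %| N & q < N]%N.
Proof.
case=> N_gt1 Npr; rewrite mem_primes => /and3P[q_pr N0 qN]; split=> //.
by rewrite ltn_neqAle dvdn_leq // andbT; apply: contraNneq Npr => <-.
Qed.

(** As 0 < c < N, some full prime power q^(v_q(N)) does not divide c, although q does; so v_q(N) >=
    2. If q^3 does not divide N, then v_q(N) = 2 and q^2 does not divide c. This leaves q = 2 with
    v_2(N) = 4, split by whether 4 divides c. *)
Lemma prime_square_or_16 N c : (0 < c < N)%N ->
    (forall q, q \in primes N -> (q %| c)%N) ->
    (cube_free N \/ exists N2, odd N2 /\ cube_free N2 /\ N = (16 * N2)%N) ->
  (exists2 q, q \in primes N & (q ^ 2 %| N) && ~~ (q ^ 2 %| c))%N \/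
  [/\ 16 %| N, 4 %| c, ~~ (16 %| c) & ~ cube_free N]%N.
Proof.
move=> /andP[c0 cN] radc Nform; have N0 := ltn_trans c0 cN.
have [q qN qc] : exists2 q, q \in primes N & ~~ (q ^ logn q N %| c)%N.
  apply/hasP; apply: contraLR cN => /hasPn allc; rewrite -leqNgt dvdn_leq //.
  apply/(dvdn_partP _ N0) => q qN; rewrite p_part.
  by apply/negPn/allc.
have := qN; rewrite mem_primes => /and3P[q_pr _ _].
have square : (~~ (q ^ 3 %| N) -> (q ^ 2 %| N) && ~~ (q ^ 2 %| c))%N.
  rewrite !pfactor_dvdn // in qc * => q3.
  have : (0 < logn q c)%N by rewrite logn_gt0 mem_primes q_pr c0 radc.
  by lia.
case: Nform => [Ncf|[N2 [N2odd [N2cf NE]]]].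
  by left; exists q => //; apply/square/Ncf.
have [q2|q2] := eqVneq q 2.
  have logN : logn 2 N = 4.
    have N2_gt0 := odd_gt0 N2odd; rewrite NE lognM // [logn 2 N2]lognE dvdn2 N2odd !andbF addn0.
    exact: (pfactorK 4 (isT : prime 2)).
  rewrite q2 logN in qc.
  have [c4|c4] := boolP (4 %| c)%N.
    right; split=> //; first by rewrite NE; exact: dvdn_mulr.
    by move/(_ 2 isT)/negP; apply; rewrite pfactor_dvdn // logN.
  left; exists 2; first by rewrite -q2.
  by rewrite c4 andbT pfactor_dvdn // logN.
left; exists q => //; apply: square.
rewrite NE Gauss_dvdr ?N2cf // coprimeXl // (coprimeXr 4 (n := 2)) //.
by rewrite prime_coprime // dvdn_prime2.
Qed.

Lemma nora_wins_odd N d : composite N -> odd d ->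
    (1 < d)%N /\ cube_free N \/
    (3 < d)%N /\ (exists N2, odd N2 /\ cube_free N2 /\ N = (16 * N2)%N) ->
  wins_game N d Nora Wanda.
Proof.
move=> N_comp; case: d => [|[|[|d]]] //.
  by move=> _ [] [].
rewrite [odd _]/= !negbK => d_even cond.
have N_gt1 := proj1 N_comp.
have card0 := @card_unchosen_start N d.+3.
apply: (@has_ws_reply _ _ Nora) => i c [pi c0].
have card1 := card_unchosen_play c pi card0.
(* If Wanda opens elsewhere than on a_0, Nora sets a_0 = 1, a unit modulo any prime factor of N. *)
have [i0|i0] := eqVneq i ord0; last first.
  have q_pr := pdiv_prime N_gt1; have qN : pdiv N \in primes N by rewrite mem_primes q_pr ltnW // pdiv_dvd.
  have [_ q_dvd q_lt] := composite_prime_lt N_comp qN.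
  have p0 : play N (start_pos N) i c (ord0 : 'I_d.+4) = None.
    by rewrite /play eq_sym -[_ == _]/(i == ord0) (negbTE i0).
  apply: (has_ws_move (legal_one p0)).
  have -> : ~~ Nora = odd d.+1 by rewrite /= d_even.
  apply: (nora_last_unit q_pr q_dvd q_lt (c := 1)) => //.
    by rewrite /= modn_small ?Zp_cast // Euclid_dvd1.
  exact: card_unchosen_play p0 card1.
subst i; move: c0 => /(_ isT) c0.
have [/hasP[q qN qc]|/hasPn radc] := boolP (has (fun q => ~~ (q %| val c)%N) (primes N)).
  have [q_pr q_dvd q_lt] := composite_prime_lt N_comp qN.
  have turnE : odd d.+2 = Nora by rewrite /= negbK (negbTE d_even).
  rewrite -[X in has_ws _ _ _ _ X _]turnE.
  by apply: (nora_last_unit q_pr q_dvd q_lt (c := c)).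
(* Now every prime of N divides a_0 = c, and Nora answers a_1 = 0. *)
pose i1 : 'I_d.+4 := Ordinal (isT : 1 < d.+4)%N.
have i1P : play N (start_pos N) (ord0 : 'I_d.+4) c i1 = None by [].
have card2 := card_unchosen_play 0 i1P card1.
apply: (has_ws_move (legal_interior 0 i1P isT)).
have c_range : (0 < val c < N)%N.
  rewrite lt0n (inj_eq val_inj c 0) c0 /=.
  by rewrite -[X in (_ < X)%N](Zp_cast N_gt1) ltn_ord.
case: (@prime_square_or_16 N (val c)) => //.
- by move=> q qN; apply/negPn/radc.
- by case: cond => [[_]|[_]]; [left|right].
- case=> q qN /andP[q2N q2c].
  have [q_pr q_dvd q_lt] := composite_prime_lt N_comp qN.
  have -> : ~~ Nora = odd d.+1 by rewrite /= d_even.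
  exact: (nora_last_square q_pr q_dvd q_lt _ _ _ q2N q2c).
case=> N16 /dvdnP[e ce] c16 Ncf.
case: cond => [[_ /Ncf] | [d_gt0 _]] //.
have cE : c = (4 * e)%:R by rewrite -[c]natr_Zp ce mulnC.
have e4 : ~~ (4 %| e)%N by rewrite ce -[16%N]/(4 * 4)%N dvdn_pmul2r in c16.
(* An odd degree above 3 is at least 5, so Nora has one more move before her last. *)
have [d' dE] : exists d', d = d'.+2.
  by case: d d_gt0 d_even {card0 card1 i1 i1P card2 pi} => [|[|d']] // _ _; exists d'.
subst d; rename d' into d; rewrite /= negbK in d_even.
set P := play N _ i1 0 in card2 *.
apply: (@has_ws_reply _ _ Nora) => i v [Pi _].
have card3 := card_unchosen_play v Pi card2.
have chosen p' j a : extends (play N P i v) p' -> P j = Some a -> p' j = Some a.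
  by move=> ext Pj; apply: ext; apply: (extends_play v (@extends_refl _ P) Pi).
have finish (k : 'I_d.+3.+3) w :
    play N P i v k = None -> (0 < k < d.+3.+2)%N ->
    (forall p', extends (play N (play N P i v) k w) p' ->
      ~~ (4 %| e + val (odflt 0%R (p' 2%N)) + 2 * val (odflt 0%R (p' 3%N)))%N) ->
  has_ws N d.+3.+2 Nora d.+3 Nora (play N P i v).
  move=> Pk k_int ok.
  apply: (has_ws_move (legal_interior w Pk k_int)).
  have -> : ~~ Nora = odd d.+1 by rewrite /= d_even.
  have ext := extends_play w (@extends_refl _ (play N P i v)) Pk.
  apply: (@nora_last_16 _ _ _ _ e) => //.
  - exact: ltnW N_gt1.
  - by rewrite -cE; apply: chosen ext _.
  - exact: chosen ext _.
  - exact: card_unchosen_play Pk card3.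
have [i2|i2] := eqVneq (val i) 2.
  (* Wanda took a_2 = v; Nora chooses a_3 = b so that e + v + 2 b is nonzero modulo 4. *)
  pose b : 'Z_N := if (4 %| e + val v)%N then 1 else 0.
  apply: (finish (Ordinal (isT : 3 < d.+3.+3)%N) b) => //.
    by rewrite /play /= i2.
  move=> p' ext; rewrite (ext 2%N v) ?(ext 3%N b) /play /= ?i2 //=.
  have [ev|ev] := boolP (4 %| e + val v)%N; rewrite /b ?ev ?(negbTE ev) /= ?addn0 ?muln0 ?addn0 //.
  by rewrite dvdn_addr // modn_small.
(* With a_2 free, Nora makes e + a_2 odd; then e + a_2 + 2 a_3 is odd for every a_3. *)
pose a : 'Z_N := if odd e then 0 else 1.
apply: (finish (Ordinal (isT : 2 < d.+3.+3)%N) a) => //.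
  by rewrite /play /= eq_sym (negbTE i2).
move=> p' ext; rewrite (ext 2%N a) /play //=.
have odd_ea : odd (e + val a).
  by rewrite oddD /a; case: (odd e) => //=; rewrite modn_small.
apply/negP => /(dvdn_trans (isT : 2 %| 4)%N).
by rewrite dvdn2 oddD oddM odd_ea.
Qed.

(** * Hensel lifting and truncated valuations *)

Section Hensel.
Variables (R : comNzRingType) (p : R).
Implicit Types (F : {poly R}) (x u v : R).

Lemma horner_taylor2 F x h :
  exists q, F.[x + h] = F.[x] + F^`().[x] * h + h ^+ 2 * q.
Proof.
elim/poly_ind: F => [|F c [q IHq]].
  by exists 0; rewrite deriv0 !horner0 mul0r mulr0 !addr0.
exists (F^`().[x] + q * (x + h)).
rewrite derivD derivM derivX derivC !hornerE IHq /=; ring.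
Qed.

(** Newton iteration with the fixed inverse u of F'(x0) modulo p. Every iterate is x0 modulo p, so u
    stays an inverse of the derivative and each step gains a factor p. *)
Lemma hensel F x0 u r s k :
    F.[x0] = p * r -> F^`().[x0] * u = 1 + p * s ->
  exists x, exists2 w, F.[x] = p ^+ k.+1 * w & exists t, x = x0 + p * t.
Proof.
move=> F0 F1; elim: k => [|k [x [w Fx [t xt]]]].
  by exists x0; exists r; rewrite ?expr1 //; exists 0; rewrite mulr0 addr0.
have [q' F1x] := horner_taylor2 F^`() x0 (p * t).
have [q Fxh] := horner_taylor2 F x (- (u * (p ^+ k.+1 * w))).
exists (x - u * (p ^+ k.+1 * w)).
exists (- w * (s + F^`()^`().[x0] * t * u + p * t ^+ 2 * q' * u) + p ^+ k * (u * w) ^+ 2 * q); last first.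
  by exists (t - u * p ^+ k * w); rewrite xt exprS; ring.
rewrite Fxh xt F1x -xt Fx; set A := F^`().[x0] in F1 *; set B := F^`()^`().[x0].
(* The two sides of the goal differ by p^(k+1) w (1 + p s - A u). *)
have A0 : 1 + p * s - A * u = 0 by rewrite F1 subrr.
apply/eqP; rewrite -subr_eq0 -[0](mulr0 (p ^+ k.+1 * w)) -A0; apply/eqP.
by rewrite !exprS; ring.
Qed.

Definition unit_mod v := exists u r, v * u = 1 + p * r.

Hypothesis dvd_or_unit : forall v, (exists w, v = p * w) \/ unit_mod v.

Lemma valuation_split j v :
  (exists w, v = p ^+ j * w) \/
  exists k v0, [/\ (k < j)%N, v = p ^+ k * v0 & unit_mod v0].
Proof.
elim: j => [|j [[w ->]|[k [v0 [kj vE v0u]]]]].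
- by left; exists v; rewrite mul1r.
- have [[w' ->]|wu] := dvd_or_unit w; last by right; exists j, w.
  by left; exists w'; rewrite exprSr mulrA.
by right; exists k, v0; split=> //; exact: ltnW.
Qed.

End Hensel.

(** * Roots forced by a_0, a_1 and a_2 modulo p^e *)

Section LocalRoots.
Variables (R : comNzRingType) (p E t : R) (e : nat).
Hypotheses (E1 : E = 1 + p ^+ e * t) (Ep : E * p ^+ e = 0).
Implicit Types F : {poly R}.

Lemma idem_E : E * E = E.
Proof. by rewrite {2}E1 mulrDr mulr1 mulrA Ep mul0r addr0. Qed.

(* Since E a_0 = a_0, one has F(E z) = E F(z). *)
Lemma root_idem F z w : E * F`_0 = F`_0 -> F.[z] = p ^+ e * w -> exists x, root F x.
Proof.
move=> EF0 Fz; exists (E * z); rewrite /root.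
have [h hP] := horner_split1 F.
suff -> : F.[E * z] = E * F.[z] by rewrite Fz mulrA Ep mul0r.
rewrite !horner_coef mulr_sumr; apply/eqP; rewrite eq_sym; apply/eqP.
apply: eq_bigr => -[[|i] i_lt] _ /=; first by rewrite !mulr1.
have EX : E ^+ i.+1 = E by elim: (i) => // k IHk; rewrite exprS IHk idem_E.
by rewrite exprMn EX mulrCA.
Qed.

Hypothesis dvd_or_unit : forall v, (exists w, v = p * w) \/ unit_mod p v.

(** The threshold j is e/3 rounded up, so 3 j >= e, while 2 j <= e - 1 precisely because e is not 4.
    If p^j divides v, the cubic and higher terms vanish at p^j and a_2 cancels the rest. Otherwise v
    = p^k v0 with k < j, and z = - p^(e-1-k) u E solves the linear part, its square being 0 modulo
    p^e. *)
Lemma forced_root_not4 v : (2 < e)%N -> e != 4 ->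
  exists a, forall F, F`_0 = E * p ^+ e.-1 -> F`_1 = v -> F`_2 = a ->
    exists x, root F x.
Proof.
move=> e_gt2 e_neq4; pose j := ((e + 2) %/ 3)%N.
have idem F : F`_0 = E * p ^+ e.-1 -> E * F`_0 = F`_0.
  by move=> ->; rewrite mulrA idem_E.
have [[w vE]|[k [v0 [kj vE [u [s us]]]]]] := valuation_split dvd_or_unit j v.
  pose m := (e - 1 - j.*2)%N; pose l := (3 * j - e)%N.
  have eE : e.-1 = (m + j + j)%N by rewrite /m /j; lia.
  have jE : (j + j + j = e + l)%N by rewrite /l /j; lia.
  exists (- (E * p ^+ m + w)) => F F0 F1 F2.
  have [h hP] := horner_split3 F.
  apply: (root_idem (z := p ^+ j) (w := p ^+ l * h.[p ^+ j]) (idem F F0)).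
  rewrite hP F0 F1 F2 vE mulrA -exprD -jE eE !exprD; ring.
pose m := (e - 1 - k)%N; pose l := (m + m - e)%N.
have eE : e.-1 = (k + m)%N by rewrite /m; lia.
have eE' : e = (k + m).+1 by lia.
have mE : (m + m = e + l)%N by rewrite /l /m; lia.
exists 0 => F F0 F1 _; have [h hP] := horner_split2 F.
pose z := - (p ^+ m * u * E).
apply: (root_idem (z := z) (w := - E * s + p ^+ l * (u * E) ^+ 2 * h.[z]) (idem F F0)).
have zz : z ^+ 2 = p ^+ e * p ^+ l * (u * E) ^+ 2 by rewrite -exprD -mE exprD /z; ring.
rewrite hP F0 F1 vE zz mulrDr !mulrA; congr (_ + _).
have -> : E * p ^+ e.-1 + p ^+ k * v0 * z = E * p ^+ e.-1 * (1 - v0 * u).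
  by rewrite eE exprD /z; ring.
by rewrite us eE [in RHS]eE' exprS; ring.
Qed.

(* Here F(p y) = p^2 G(y) modulo p^4, and x0 is a simple root of G modulo p. *)
Lemma root_scaled F b x0 u r s : e = 4 ->
    F`_0 = E * p ^+ 2 -> F`_1 = p * b ->
    E + b * x0 + F`_2 * x0 ^+ 2 = p * r -> (b + 2%:R * F`_2 * x0) * u = 1 + p * s ->
  exists x, root F x.
Proof.
move=> e4 F0 F1 Gx0 G'x0.
pose G := E%:P + b%:P * 'X + (F`_2)%:P * 'X ^+ 2 + (p * F`_3)%:P * 'X ^+ 3.
have GE y : G.[y] = E + b * y + F`_2 * y ^+ 2 + p * F`_3 * y ^+ 3.
  by rewrite /G !hornerE.
have G0 : G.[x0] = p * (r + F`_3 * x0 ^+ 3).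
  by rewrite GE Gx0; ring.
have G1 : G^`().[x0] * u = 1 + p * (s + 3%:R * F`_3 * x0 ^+ 2 * u).
  have -> : G^`().[x0] = b + 2%:R * F`_2 * x0 + p * (3%:R * F`_3 * x0 ^+ 2).
    by rewrite /G !derivE !hornerE /=; ring.
  by rewrite mulrDl G'x0; ring.
have [y [w Gy _]] := hensel 1 G0 G1.
have [h hP] := horner_split4 F.
apply: (root_idem (z := p * y) (w := w + y ^+ 4 * h.[p * y])).
  by rewrite F0 mulrA idem_E.
have p4w : p ^+ 4 * w = p ^+ 2 * G.[y] by rewrite Gy; ring.
by rewrite e4 mulrDr p4w hP F0 F1 GE; ring.
Qed.

Lemma root_unit F u s : (1 < e)%N ->
  F`_0 = E * p ^+ 2 -> F`_1 * u = 1 + p * s -> exists x, root F x.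
Proof.
move=> e1 F0 F1.
have F00 : F.[0] = p * (p * E) by rewrite horner_coef0 F0; ring.
have F10 : F^`().[0] * u = 1 + p * s by rewrite horner_coef0 coef_deriv.
have [x [w Fx _]] := hensel e.-1 F00 F10.
apply: (root_idem (z := x) (w := w)); first by rewrite F0 mulrA idem_E.
by rewrite Fx prednK // ltnW.
Qed.

(** For k = 0, the root 0 modulo p is simple and lifts. For k = 1, the scaled polynomial is E + v y
    modulo p, with simple root - u E. *)
Lemma root_low_valuation F k v u s : e = 4 -> (k < 2)%N -> v * u = 1 + p * s ->
  F`_0 = E * p ^+ 2 -> F`_1 = p ^+ k * v -> F`_2 = 0 -> exists x, root F x.
Proof.
move=> e4; case: k => [|[|//]] _ vu F0 F1 F2.
  by apply: (root_unit (u := u) (s := s) _ F0); rewrite ?e4 // F1 mul1r.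
apply: (root_scaled (b := v) (x0 := - (u * E)) (u := u) (r := - s * E) (s := s) e4 F0).
- by rewrite F1 expr1.
- rewrite F2; have -> : E + v * - (u * E) + 0 * (- (u * E)) ^+ 2 = E * (1 - v * u) by ring.
  by rewrite vu; ring.
by rewrite F2 mulr0 mul0r addr0.
Qed.

Lemma forced_root_4 v : e = 4 ->
  (exists u s, 2%:R * u = 1 + p * s) ->
  exists a, forall F, F`_0 = E * p ^+ 2 -> F`_1 = v -> F`_2 = a ->
    exists x, root F x.
Proof.
move=> e4 [u2 [s2 us2]].
have [[w vE]|[k [v0 [kj vE [u [s us]]]]]] := valuation_split dvd_or_unit 2 v.
  (* The scaled polynomial is 1 - y^2 modulo p, and its root 1 is simple because 2 is invertible
     modulo p. *)
  exists (-1) => F F0 F1 F2.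
  apply: (root_scaled (b := p * w) (x0 := 1) (u := - u2) (r := p ^+ 3 * t + w)
    (s := s2 - w * u2) e4 F0); rewrite ?F1 ?F2 ?vE; first by ring.
    by rewrite {1}E1 e4; ring.
  have -> : (p * w + 2%:R * -1 * 1) * - u2 = 2%:R * u2 - p * (w * u2) by ring.
  by rewrite us2; ring.
by exists 0 => F F0; rewrite vE => F1 F2; exact: (root_low_valuation e4 kj us F0 F1 F2).
Qed.

End LocalRoots.

Section CubicMod16.
Variables (R : comNzRingType) (E t : R).
Hypotheses (E1 : E = 1 + 2%:R ^+ 4 * t) (Ep : E * 2%:R ^+ 4 = 0).
Hypothesis parity : forall v : R, exists w, v = 2%:R * w \/ v = 1 + 2%:R * w.

(** The value of a_2 is fixed before a_3 is known, so it has to serve both parities of a_3. The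
    bound on the size matters because the value at 1 involves all coefficients. *)
Lemma forced_root_cubic v :
  exists a, forall F : {poly R}, (size F <= 4)%N -> F`_0 = E * 2%:R ^+ 2 -> F`_1 = v -> F`_2 = a ->
    exists x, root F x.
Proof.
have unit2 (w : R) : unit_mod 2%:R (1 + 2%:R * w) by exists 1, w; rewrite mulr1.
have dvd_or_unit (x : R) : (exists w, x = 2%:R * w) \/ unit_mod 2%:R x.
  by have [w [->|->]] := parity x; [left; exists w | right].
have [[w vE]|[k [v0 [kj vE [u [s us]]]]]] := valuation_split dvd_or_unit 2 v.
  exists (- (1 + 2%:R * w)) => F sF F0 F1 F2.
  have idem : E * F`_0 = F`_0 by rewrite F0 mulrA (idem_E E1 Ep).
  have FE x : F.[x] = F`_0 + F`_1 * x + F`_2 * x ^+ 2 + F`_3 * x ^+ 3.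
    by rewrite (horner_coef_wide _ sF) !big_ord_recl big_ord0 /= mulr1 addr0 !addrA.
  (* If a_3 is even then 2 is a root modulo 16; otherwise 1 is a simple root modulo 2. *)
  have [b [F3|F3]] := parity F`_3.
    apply: (root_idem E1 Ep (z := 2%:R) (w := 2%:R ^+ 2 * t + b) idem).
    by rewrite FE F0 F1 F2 F3 vE {1}E1; ring.
  pose G := (F`_0)%:P + (F`_1)%:P * 'X + (F`_2)%:P * 'X ^+ 2 + (F`_3)%:P * 'X ^+ 3.
  have G1 : G.[1] = 2%:R * (2%:R * E + w + b).
    by rewrite /G !hornerE F0 F1 F2 F3 vE /=; ring.
  have G'1 : G^`().[1] * 1 = 1 + 2%:R * (3%:R * b).
    by rewrite /G !derivE !hornerE F1 F2 F3 vE /=; ring.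
  have [x [y Gx _]] := hensel 3 G1 G'1.
  by apply: (root_idem E1 Ep (z := x) (w := y) idem); rewrite FE -Gx /G !hornerE.
exists 0 => F _ F0; rewrite vE => F1 F2.
exact: (root_low_valuation E1 Ep erefl kj us F0 F1 F2).
Qed.

End CubicMod16.

(** * Wanda's openings when Nora moves last *)

(** By the Chinese remainder theorem some K is 1 modulo p^e and 0 modulo N/p^e. The last conclusion
    makes Wanda's opening a_0 = E p^k legal. *)
Lemma exists_idempotent N p e : prime p -> (0 < e)%N -> logn p N = e ->
  exists E t : 'Z_N, [/\ E = 1 + p%:R ^+ e * t, E * p%:R ^+ e = 0 &
    forall k, (k < e)%N -> E * p%:R ^+ k != 0].
Proof.
move=> p_pr e0 logN.
have N0 : (0 < N)%N by move: e0; rewrite -logN logn_gt0 mem_primes => /and3P[].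
have p1 := prime_gt1 p_pr.
have [M pM NE] := pfactor_coprime p_pr N0; rewrite logN in NE.
have pe1 : (1 < p ^ e)%N by rewrite -(exp1n e) ltn_exp2r.
have N_gt1 : (1 < N)%N.
  by rewrite (leq_trans pe1) // NE leq_pmull //; case: M NE N0 {pM} => // ->.
have natr0 n : (n%:R == 0 :> 'Z_N) = (N %| n)%N by rewrite -val_eqE /= val_Zp_nat.
have peM : coprime (p ^ e) M by rewrite coprimeXl.
pose K := chinese (p ^ e) M 1 0.
have K1 : (K %% p ^ e = 1)%N by rewrite chinese_modl // modn_small.
have KM : (M %| K)%N by rewrite /dvdn chinese_modr // mod0n.
exists K%:R, (K %/ p ^ e)%:R; split.
- by rewrite {1}(divn_eq K (p ^ e)) K1 natrD natrM natrX addrC mulrC.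
- by apply/eqP; rewrite -natrX -natrM natr0 NE dvdn_mul.
move=> k ke; rewrite -natrX -natrM natr0; apply/negP => NK.
have : (p ^ e %| K * p ^ k)%N by apply: dvdn_trans NK; rewrite NE dvdn_mull.
rewrite Gauss_dvdr; first by rewrite dvdn_Pexp2l // leqNgt ke.
by rewrite -coprime_modr K1 coprimen1.
Qed.

Lemma natr_dvd_or_unit N p (v : 'Z_N) : prime p ->
  (exists w, v = p%:R * w) \/ unit_mod p%:R v.
Proof.
move=> p_pr; have [/dvdnP[w vw]|pv] := boolP (p %| val v)%N.
  by left; exists w%:R; rewrite -[LHS]natr_Zp vw natrM mulrC.
right; rewrite -prime_coprime // coprime_sym in pv.
have v0 : (0 < val v)%N.
  by rewrite lt0n; apply: contraTneq pv => ->; rewrite /coprime gcd0n gtn_eqF // prime_gt1.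
have [kv kp e _] := egcdnP p v0.
exists kv%:R, kp%:R.
by rewrite -[v in LHS]natr_Zp -!natrM mulnC e (eqP pv) natrD addrC [(p * kp)%N]mulnC.
Qed.

Lemma wanda_opening N d (c : 'Z_N) : c != 0 -> c ^+ 2 = 0 ->
    (forall v, exists a, forall F : {poly 'Z_N}, (size F <= d.+4)%N ->
       F`_0 = c -> F`_1 = v -> F`_2 = a -> exists x, root F x) ->
  wins_game N d.+3 Wanda Wanda.
Proof.
move=> c0 cc force; have card0 := @card_unchosen_start N d.+3.
apply: (@has_ws_move _ _ Wanda _ _ ord0 c); first exact: legal_nonzero.
have start0 : start_pos N (ord0 : 'I_d.+4) = None by [].
have card1 := card_unchosen_play c start0 card0.
apply: (@has_ws_reply _ _ Wanda) => i v [pi _].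
have card2 := card_unchosen_play v pi card1; set P := play N _ i v in card2 *.
have P0 : P 0%N = Some c by apply: (extends_play v (@extends_refl _ _) pi).
have [i1|i1] := eqVneq (val i) 1%N.
  have [a aP] := force v.
  pose i2 : 'I_d.+4 := Ordinal (isT : 2 < d.+4)%N.
  have Pi2 : P i2 = None by rewrite /P /play /= i1.
  apply: (has_ws_move (legal_interior a Pi2 isT)).
  apply: wanda_certain (card_unchosen_play a Pi2 card2) => p ext.
  have extP := extends_play a (@extends_refl _ P) Pi2.
  apply: aP; first exact: size_poly.
  - by apply: coef_final => //; apply/ext/extP.
  - by apply: coef_final => //; apply/ext/extP; rewrite /P /play i1.
  - by apply: coef_final => //; apply: ext; rewrite play_self.
(* Nora left a_1 free, so Wanda takes it: with a_1 = 1, f(-c) = c - c + c^2 h(-c) = 0. *)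
pose i2 : 'I_d.+4 := Ordinal (isT : 1 < d.+4)%N.
have Pi2 : P i2 = None by rewrite /P /play /= eq_sym (negbTE i1).
apply: (has_ws_move (legal_one Pi2)).
apply: wanda_certain (card_unchosen_play 1 Pi2 card2) => p ext.
have extP := extends_play 1 (@extends_refl _ P) Pi2.
exists (- c); rewrite /root; have [h ->] := horner_split2 (final_poly N d.+3 p).
rewrite (coef_final (a := c)) //; last by apply/ext/extP.
rewrite (coef_final (a := 1)) //; last by apply: ext; rewrite play_self.
by rewrite sqrrN cc mul1r subrr mul0r addr0.
Qed.

Lemma wanda_wins_degree1 N : wins_game N 1 Wanda Wanda.
Proof.
apply: (@has_ws_move _ _ Wanda _ _ ord_max 1); first exact: legal_one.
apply: (@wanda_certain _ _ _ 1); last first.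
  by apply: (@card_unchosen_play _ _ _ ord_max) => //; exact: card_unchosen_start.
move=> p ext; exists (- (final_poly N 1 p)`_0).
rewrite /root horner_poly !big_ord_recl big_ord0 /= coef_poly /=.
by rewrite (ext 1%N 1) //= mulr1 addr0 mul1r subrr.
Qed.

Lemma wanda_wins_prime_power N d p : prime p -> (2 < logn p N)%N ->
  [\/ logn p N != 4, odd p | d = 0%N] -> wins_game N d.+3 Wanda Wanda.
Proof.
move=> p_pr e_gt2 cases; set e := logn p N in e_gt2 cases.
have e_gt0 : (0 < e)%N by rewrite ltnW // ltnW.
have [E [t [E1 Ep E_neq0]]] := @exists_idempotent N p e p_pr e_gt0 erefl.
have dou v := @natr_dvd_or_unit N p v p_pr.
have sq k : (e <= k + k)%N -> (E * p%:R ^+ k) ^+ 2 = 0.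
  move=> ek; rewrite expr2 mulrACA (idem_E E1 Ep) -exprD -(subnKC ek) exprD mulrA.
  by rewrite Ep mul0r.
have [e4|e_neq4] := eqVneq e 4; last first.
  apply: (@wanda_opening _ _ (E * p%:R ^+ e.-1)); [|apply: sq; lia|].
    by apply: E_neq0; rewrite prednK.
  move=> v; have [a aP] := forced_root_not4 E1 Ep dou v e_gt2 e_neq4.
  by exists a => F _; apply: aP.
apply: (@wanda_opening _ _ (E * p%:R ^+ 2)); [|apply: sq; lia|].
  by apply: E_neq0; rewrite e4.
move=> v; have [p_odd|p_even] := boolP (odd p).
  have [|a aP] := forced_root_4 E1 Ep dou v e4; last by exists a => F _; apply: aP.
  (* For odd p, twice -(p - 1)/2 is 1 - p. *)
  exists (- (p./2)%:R), (-1).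
  have -> : p%:R = 1 + 2%:R * (p./2)%:R :> 'Z_N.
    by rewrite -natrM mul2n -{1}[p]odd_double_half p_odd natrD.
  ring.
have d0 : d = 0%N by case: cases; rewrite ?e4 // (negbTE p_even).
have p2 : p = 2%N by case: (even_prime p_pr) => // p_odd; rewrite p_odd in p_even.
rewrite d0; rewrite e4 p2 in E1 Ep *; apply: forced_root_cubic E1 Ep _ v => x.
have xE : x = (odd (val x))%:R + 2%:R * (val x)./2%:R.
  by rewrite -natrM -natrD mul2n odd_double_half natr_Zp.
exists (val x)./2%:R; case: (odd _) xE; first by right.
by rewrite add0r; left.
Qed.

(** The only unsuitable prime is 2 with exponent exactly 4 in degree above 3. Then the odd part of N
    is not cube-free and supplies an odd prime. *)
Lemma exists_forcing_prime N d : (0 < N)%N -> ~ cube_free N ->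
    ~ ((3 < d.+3)%N /\ (exists N2, odd N2 /\ cube_free N2 /\ N = (16 * N2)%N)) ->
  exists p, [/\ prime p, (2 < logn p N)%N & [\/ logn p N != 4, odd p | d = 0%N]].
Proof.
move=> N0 Ncf not16.
have cubeP m : (0 < m)%N -> ~ cube_free m -> exists2 p, prime p & (2 < logn p m)%N.
  move=> m0 mcf; have [/hasP[p]|/hasPn cf] := boolP (has (fun p => 2 < logn p m)%N (primes m)).
    by rewrite mem_primes => /and3P[p_pr _ _]; exists p.
  case: mcf => p p_pr; rewrite pfactor_dvdn //; apply/negP => p3.
  have pm : p \in primes m by rewrite -logn_gt0 (leq_trans _ p3).
  by have := cf p pm; rewrite p3.
have [p p_pr p3] := cubeP N N0 Ncf.
case: d not16 => [|d] not16; first by exists p; split=> //; apply: Or33.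
have [p4|p4] := eqVneq (logn p N) 4; last by exists p; split=> //; apply: Or31.
have [p_odd|p_even] := boolP (odd p); first by exists p; split=> //; apply: Or32.
have p2 : p = 2%N by case: (even_prime p_pr) => // p_odd; rewrite p_odd in p_even.
subst p; have [N2 N2odd NE] := pfactor_coprime (isT : prime 2) N0.
rewrite p4 in NE; rewrite coprime2n in N2odd.
have N2_gt0 := odd_gt0 N2odd; have [] := cubeP N2 N2_gt0.
  by move=> cf; apply: not16; split=> //; exists N2; rewrite NE mulnC.
move=> q q_pr q3; exists q; split=> //.
  by rewrite NE lognM // ltn_addr.
apply: Or32; case: (even_prime q_pr) => // q2.
by move: q3; rewrite q2 lognE dvdn2 N2odd andbF.
Qed.

Theorem theorem1 (d N : nat) (hd : (1 <= d)%N) (hN : composite N) (first : bool) :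
  let cond :=
    ~~ odd d \/
    ((1 < d)%N /\ cube_free N) \/
    ((3 < d)%N /\ exists N2 : nat, odd N2 /\ cube_free N2 /\ N = (16 * N2)%N) in
  (cond -> wins_game N d (last_player d first) first) /\
  (~ cond -> wins_game N d Wanda first).
Proof.
move=> cond; have [N_gt1 Npr] := hN.
have N_gt2 : (2 < N)%N by case: N {hN cond} N_gt1 Npr => [|[|[|]]].
case last: (last_player d first).
  by have W := wanda_wins_last N_gt2 hd last; split.
have [d_odd|d_even] := boolP (odd d); last first.
  split=> [_|[]]; last by left.
  case: first last; rewrite /last_player -[odd d.+1]/(~~ odd d) d_even //= => _.
  exact: nora_wins_even.
case: first last; rewrite /last_player -[odd d.+1]/(~~ odd d) d_odd //= => _.
split=> [[|]|ncond]; [by rewrite d_odd | exact: nora_wins_odd |].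
(* Here d is odd, Wanda opens and Nora moves last; d = 1 is settled apart from odd d >= 3. *)
case: d hd d_odd @cond ncond => [|[|[|d]]] // _ d_odd cond ncond.
  exact: wanda_wins_degree1.
have [] := @exists_forcing_prime N d (ltnW N_gt1).
- by move=> cf; apply: ncond; right; left.
- by move=> c; apply: ncond; right; right.
by move=> p [p_pr p3 cases]; exact: wanda_wins_prime_power cases.
Qed.
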